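(* Let $G$ be a trusted-repeater network in which Alice and Bob are connected by $n$ pairwise disjoint paths $P_1,\dots,P_n$, each of length at most $\ell$ (write $\ell_i\le\ell$ for the number of edges of $P_i$). Let the QKD keys $q_{i,j}$ ($1\le i\le n$, $1\le j\le\ell_i$) shared across the edges each be $\varepsilon$-private against quantum side information. Let $\Pi_r$ be the relay protocol that uses the scheme $\mathsf{Share}^*=\mathsf{Share}\circ\mathsf{Encode}$, $\mathsf{Recover}^*=\mathsf{Decode}\circ\mathsf{Recover}$, built from a perfectly confidential linear secret-sharing scheme $(\mathsf{Share},\mathsf{Recover})$ and an AMD code $(\mathsf{Encode},\mathsf{Decode})$, and relays the $i$-th share over path $P_i$ by one-time-pad decryption and re-encryption. Then, for all (computationally unbounded) adversaries $\mathcal{A}$, $$\left|\Pr[\text{Ind-Relay}(\Pi_r,\mathcal{A})=1]-\tfrac12\right|\le n\,\ell\,\varepsilon .$$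
   Context: **Missing values.** $\bot$ denotes a missing value; $\bot+x=x+\bot=\bot$ for all $x$ (likewise for subtraction). **Secret sharing.** Fix $n$ and an access structure, which determines which subsets of $\{1,\dots,n\}$ are *qualified*; other subsets are *unqualified*. A secret-sharing scheme is a pair $(\mathsf{Share},\mathsf{Recover})$: the probabilistic function $\mathsf{Share}$ sends a secret $S$ in a secret space to a vector of shares $(S_1,\dots,S_n)\in\mathcal{Y}^n$, where here $\mathcal{Y}$ is a finite additive group; $\mathsf{Recover}$ maps a vector in $(\mathcal{Y}\cup\{\bot\})^n$ to a secret or to $\bot$ (shares may be missing, and recovery may fail or reject, in which case the output is $\bot$). Correctness: for every qualified $B$, replacing by $\bot$ the shares with index outside $B$ and applying $\mathsf{Recover}$ gives $S$. *Perfectly confidential*: for every unqualified $A$, the shares $(S_i)_{i\in A}$ reveal no information about $S$, i.e. their distribution does not depend on $S$. *Linear*: the secret space is an additive group $\mathcal{G}$ and $\mathsf{Recover}(\vec S+\vec S')=\mathsf{Recover}(\vec S)+\mathsf{Recover}(\vec S')$, with componentwise addition; formally, linearity is only with respect to non-missing shares. **AMD code.** A $\delta$-AMD code is a probabilistic map $\mathsf{Encode}:\mathcal{S}\to\mathcal{G}$ from a set to a group and a map $\mathsf{Decode}:\mathcal{G}\to\mathcal{S}\cup\{\bot\}$ with $\mathsf{Decode}(\mathsf{Encode}(s))=s$ with probability $1$ for all $s\in\mathcal{S}$, and $\Pr[\mathsf{Decode}(\mathsf{Encode}(s)+\Delta)\notin\{s,\bot\}]\le\delta$ for all $s\in\mathcal{S}$,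 $\Delta\in\mathcal{G}$. Set $\mathsf{Decode}(\bot)=\bot$. Here $\mathcal{G}$ is the secret space of $(\mathsf{Share},\mathsf{Recover})$. An AMD code is a $\delta$-AMD code for some $\delta$. **Network and keys.** The network is static; Alice and Bob are honest. Paths are disjoint if they share no vertex other than Alice and Bob. Key $q_{i,j}\in\mathcal{Y}$ belongs to the $j$-th edge of $P_i$ and is held identically by both endpoints of that edge. A classical-quantum state $\rho_{XE}=\sum_x P_X(x)|x\rangle\langle x|\otimes\rho_E^x$, the joint state of a classical variable $X$ (a key) and the adversary's quantum system $E$, is *$\varepsilon$-private against quantum side information* if $\frac12\|\rho_{XE}-\rho_U\otimes\rho_E\|_1\le\varepsilon$, where $\rho_U=\sum_x\frac1{|\mathcal{X}|}|x\rangle\langle x|$ is the uniform distribution over the set $\mathcal{X}$ of values of $X$ (here $\mathcal{X}=\mathcal{Y}$), $\rho_E=\sum_xP_X(x)\rho_E^x$, and $\|\cdot\|_1$ is the trace norm. The hypothesis is that each individual key $q_{i,j}$ is $\varepsilon$-private in this sense. **Game Ind-Relay$(\Pi_r,\mathcal{A})$**, with $\mathcal{A}=(\mathcal{A}_0,\mathcal{A}_1)$: 1. Sample $b\in\{0,1\}$ uniformly; $\mathcal{A}_0$ outputs $s_0,s_1\in\mathcal{S}$. 2. $\vec S=(S_1,\dots,S_n)\leftarrow\mathsf{Share}^*(s_b)$. 3. All keys $q_{i,j}$ are sampled by QKD (the adversary holding the side information $E$). 4. $c_{i,1}=S_i+q_{i,1}$ for all $1\le i\le n$. 5. $\mathcal{A}_1$,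 given $(c_{1,1},\dots,c_{n,1})$ and with adaptive access to the oracles Relay and Corrupt, outputs a bit $b'$. 6. The game outputs $1$ if $b=b'$ and the set $T$ is unqualified, and $0$ otherwise. The game maintains sets $R$ and $T$, initially empty. Oracles, for $1\le i\le n$, $2\le j\le\ell_i$ (node $j$ of path $i$, which lies between edges $j-1$ and $j$): - Relay$(i,j,c')$: if $(i,j)\in R$ return $\bot$; otherwise add $(i,j)$ to $R$ and return $c'-q_{i,j-1}+q_{i,j}$. - Corrupt$(i,j)$: if $(i,j)\in R$ return $\bot$; otherwise add $i$ to $T$ and return $(q_{i,j-1},q_{i,j})$.
   Formalization: Each key is assumed ε-private against E together with all other keys (automatic for independent links); the two-sided bound is claimed only for adversaries whose T is unqualified with probability 1, and for all others only Pr ≤ 1/2 + nℓε. The printed claim fails without these. *)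

(* Defs.v *)
From HB Require Import structures.
From mathcomp Require Import all_boot all_order all_algebra.
From mathcomp.real_closed Require Import mxtens.

Set Implicit Arguments.
Unset Strict Implicit.
Unset Printing Implicit Defensive.

Import Order.TTheory GRing.Theory Num.Theory.
Local Open Scope ring_scope.
Local Open Scope sesquilinear_scope.

(* The field of complex numbers is an arbitrary C : numClosedFieldType.  Its
   order is partial and "x <= y" entails that y - x is real, so probabilities
   are taken directly in C. *)

Section Distributions.
Variable C : numClosedFieldType.

Record dist (T : finType) := Dist {
  pmf :> {ffun T -> C};
  pmf_ge0 : forall x, 0 <= pmf x;
  pmf_sum1 : \sum_x pmf x = 1 }.

Definition Pr (T : finType) (p : dist T) (E : pred T) : C := \sum_(x | E x) p x.

Section Bind.
Variables (T U : finType) (p : dist T) (f : T -> dist U).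

Definition dbind_pmf : {ffun U -> C} := [ffun u => \sum_x p x * f x u].

Fact dbind_ge0 u : 0 <= dbind_pmf u.
Proof. by rewrite ffunE sumr_ge0 // => x _; rewrite mulr_ge0 ?pmf_ge0. Qed.

Fact dbind_sum1 : \sum_u dbind_pmf u = 1.
Proof.
under eq_bigr do rewrite ffunE.
rewrite exchange_big /= -(pmf_sum1 p); apply: eq_bigr => x _.
by rewrite -mulr_sumr pmf_sum1 mulr1.
Qed.

Definition dbind : dist U := Dist dbind_ge0 dbind_sum1.
End Bind.

End Distributions.

Section QuantumStates.
Variable C : numClosedFieldType.

(* Over C, nonnegativity of the quadratic form already forces A to be
   Hermitian. *)
Definition psdmx d (A : 'M[C]_d) : Prop :=
  forall v : 'rV[C]_d, 0 <= (v *m A *m v^t*) 0 0.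

(* tr sqrt(A^* A): A^* A is normal, spectral_diag lists its eigenvalues with
   multiplicity. *)
Definition trace_norm d (A : 'M[C]_d) : C :=
  \sum_i sqrtC (spectral_diag (A^t* *m A) 0 i).

Definition ketbra (X : finType) (x : X) : 'M[C]_#|X| :=
  delta_mx (enum_rank x) (enum_rank x).

Definition uniform_mx (X : finType) : 'M[C]_#|X| :=
  \sum_x #|X|%:R^-1 *: ketbra x.

(* A classical-quantum state is given by the subnormalized operators
   w x = P_X(x) rho_E^x. *)
Record cq_state (X : finType) (d : nat) := CQState {
  cq_op :> X -> 'M[C]_d;
  cq_psd : forall x, psdmx (cq_op x);
  cq_tr1 : \sum_x \tr (cq_op x) = 1 }.

Definition cq_mx (X : finType) d (w : X -> 'M[C]_d) : 'M[C]_(#|X| * d) :=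
  \sum_x (ketbra x *t w x).

Definition quantum_marginal (X : finType) d (w : X -> 'M[C]_d) : 'M[C]_d :=
  \sum_x w x.

Definition eps_private (X : finType) d (eps : C) (w : X -> 'M[C]_d) : Prop :=
  2^-1 * trace_norm (cq_mx w - uniform_mx X *t quantum_marginal w) <= eps.

(* For w the joint state of a family of keys (indexed by I) and a quantum
   system E: the state of the single key k e together with everything outside
   it, namely E and a classical register holding the keys k e' for e' != e.
   For jointly independent pairs (key, part of E) the extra register does not
   change the distance to uniform; without it, individually private keys could
   be all equal, or E could hold the difference of two keys. *)
Definition other_keys (I Y : finType) (e : I) (k : {ffun I -> Y}) :
    {ffun {e' : I | e' != e} -> Y} :=
  [ffun e' => k (val e')].

Definition key_and_rest (I Y : finType) d (w : {ffun I -> Y} -> 'M[C]_d) (e : I)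
    (x : Y) : 'M[C]_(#|{: {ffun {e' : I | e' != e} -> Y}}| * d) :=
  \sum_(k : {ffun I -> Y} | k e == x) (ketbra (other_keys e k) *t w k).

End QuantumStates.

Section SecretSharing.
Variables (C : numClosedFieldType) (n : nat) (Y G : finZmodType).

Local Notation shares := {ffun 'I_n -> Y}.
Local Notation partial_shares := {ffun 'I_n -> option Y}.

Definition oadd (H : zmodType) (x y : option H) : option H :=
  if x is Some a then if y is Some b then Some (a + b) else None else None.

Definition vadd (u v : partial_shares) : partial_shares :=
  [ffun i => oadd (u i) (v i)].

Definition mask (B : {set 'I_n}) (y : shares) : partial_shares :=
  [ffun i => if i \in B then Some (y i) else None].

Definition correct_sharing (Q : {set {set 'I_n}}) (Share : G -> dist C shares)
    (Recover : partial_shares -> option G) : Prop :=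
  forall (B : {set 'I_n}) (g : G), B \in Q ->
    Pr (Share g) [pred y | Recover (mask B y) == Some g] = 1.

Definition perfectly_confidential (Q : {set {set 'I_n}})
    (Share : G -> dist C shares) : Prop :=
  forall (A : {set 'I_n}) (g g' : G) (v : partial_shares), A \notin Q ->
    Pr (Share g) [pred y | mask A y == v] = Pr (Share g') [pred y | mask A y == v].

(* Both summands have the same missing shares. *)
Definition linear_recover (Recover : partial_shares -> option G) : Prop :=
  forall (B : {set 'I_n}) (y y' : shares),
    Recover (vadd (mask B y) (mask B y'))
      = oadd (Recover (mask B y)) (Recover (mask B y')).

Definition amd_code (S : finType) (delta : C) (Encode : S -> dist C G)
    (Decode : G -> option S) : Prop :=
  (forall s, Pr (Encode s) [pred g | Decode g == Some s] = 1) /\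
  (forall s (D : G),
     Pr (Encode s) [pred g | Decode (g + D) \notin [:: Some s; None]] <= delta).

End SecretSharing.

Record relay_protocol (C : numClosedFieldType) (n : nat) (Y : finZmodType)
    (S : finType) := RelayProtocol {
  protocol_share : S -> dist C {ffun 'I_n -> Y};
  protocol_recover : {ffun 'I_n -> option Y} -> option S }.

Definition relay_protocol_of (C : numClosedFieldType) (n : nat)
    (Y G : finZmodType) (S : finType)
    (Share : G -> dist C {ffun 'I_n -> Y})
    (Recover : {ffun 'I_n -> option Y} -> option G)
    (Encode : S -> dist C G) (Decode : G -> option S) : relay_protocol C n Y S :=
  RelayProtocol (fun s => dbind (Encode s) Share)
                (fun v => obind Decode (Recover v)).

(* Path i is alice :: rcons (repeaters i) bob. *)
Record repeater_network (n : nat) := RepeaterNetwork {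
  vertex : finType;
  link : rel vertex;
  link_sym : symmetric link;
  link_irr : irreflexive link;
  alice : vertex;
  bob : vertex;
  alice_neq_bob : alice != bob;
  repeaters : 'I_n -> seq vertex;
  repeaters_path : forall i, path link alice (rcons (repeaters i) bob);
  repeaters_uniq : forall i, uniq (alice :: rcons (repeaters i) bob);
  repeaters_disjoint : forall i j, i != j ->
    [disjoint repeaters i & repeaters j] }.

Section Edges.
Variables (n : nat) (N : repeater_network n).

Definition path_length (i : 'I_n) : nat := (size (repeaters N i)).+1.

(* Counting from 0, repeater k of a path lies between its edges k and k.+1. *)
Definition edge : finType := {i : 'I_n & 'I_(path_length i)}.
Definition node : finType := {i : 'I_n & 'I_(size (repeaters N i))}.

Definition first_edge (i : 'I_n) : edge :=
  Tagged (fun i => 'I_(path_length i)) (ord0 : 'I_(path_length i)).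
Definition edge_before (v : node) : edge :=
  Tagged (fun i => 'I_(path_length i)) (widen_ord (leqnSn _) (tagged v)).
Definition edge_after (v : node) : edge :=
  Tagged (fun i => 'I_(path_length i)) (lift ord0 (tagged v)).

End Edges.

Section Game.
Variables (C : numClosedFieldType) (n : nat) (Y : finZmodType) (S : finType).
Variable N : repeater_network n.

Local Notation keys := {ffun edge N -> Y}.

(* A strategy holding a d-dimensional quantum system.  Instrument m d' K is the
   quantum operation with Kraus operators K o, whose outcome o is observed; it
   also provides for private randomness and for changing the memory size. *)
Inductive strategy : nat -> Type :=
| Guess d (b : bool) : strategy d
| AskRelay d (v : node N) (c : Y) (next : option Y -> strategy d) : strategy d
| AskCorrupt d (v : node N) (next : option (Y * Y) -> strategy d) : strategy d
| Instrument d m d' (K : 'I_m -> 'M[C]_(d', d))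
    (complete : \sum_o ((K o)^t* *m K o) = 1%:M)
    (next : 'I_m -> strategy d') : strategy d.

(* Probability that the interaction with the oracles, started from the sets
   R and T, ends with a guess b' and a set T such that ev b' T, the initial
   state of the quantum system being the subnormalized operator rho. *)
Fixpoint run (q : keys) (ev : bool -> {set 'I_n} -> bool) (d : nat)
    (A : strategy d) (R : {set node N}) (T : {set 'I_n}) : 'M[C]_d -> C :=
  match A in strategy d return 'M[C]_d -> C with
  | Guess _ b => fun rho => if ev b T then \tr rho else 0
  | AskRelay _ v c next => fun rho =>
      if v \in R then run q ev (next None) R T rho
      else run q ev (next (Some (c - q (edge_before v) + q (edge_after v))))
             (v |: R) T rho
  | AskCorrupt _ v next => fun rho =>
      if v \in R then run q ev (next None) R T rho
      else run q ev (next (Some (q (edge_before v), q (edge_after v))))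
             R (tag v |: T) rho
  | Instrument _ _ _ K _ next => fun rho =>
      \sum_o run q ev (next o) R T (K o *m rho *m (K o)^t* )
  end.

(* adv_choose samples (s0, s1) and the state passed on to adv_attack.  That
   state is classical without loss of generality: the first stage has no
   quantum input, so adv_attack can prepare any quantum memory from its
   classical description.  d is the dimension of the side information. *)
Record adversary (d : nat) := Adversary {
  adv_state : finType;
  adv_choose : dist C (S * S * adv_state)%type;
  adv_attack : adv_state -> {ffun 'I_n -> Y} -> strategy d }.

Definition first_ciphertexts (y : {ffun 'I_n -> Y}) (q : keys) :
    {ffun 'I_n -> Y} :=
  [ffun i => y i + q (first_edge N i)].

(* Probability of an event on (b, b', T) in the game, w being the joint state
   of all the keys and of the side information. *)
Definition ind_relay_pr (Pi : relay_protocol C n Y S) d (w : cq_state C keys d)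
    (A : adversary d) (ev : bool -> bool -> {set 'I_n} -> bool) : C :=
  \sum_(b : bool) 2^-1 *
  \sum_(z : S * S * adv_state A) adv_choose A z *
  \sum_(y : {ffun 'I_n -> Y})
    protocol_share Pi (if b then z.1.2 else z.1.1) y *
  \sum_(q : keys)
    run q (ev b) (adv_attack z.2 (first_ciphertexts y q)) set0 set0 (w q).

Definition ind_relay_win (Q : {set {set 'I_n}}) (b b' : bool) (T : {set 'I_n}) :=
  (b == b') && (T \notin Q).

Definition corrupts_unqualified (Q : {set {set 'I_n}}) (b b' : bool)
    (T : {set 'I_n}) :=
  T \notin Q.

End Game.

(* Main.v *)
(* The keys are replaced one at a time by a fresh uniform value, i.e. the joint
   state is averaged over all shifts of that key.  The whole game is a positive
   functional of the joint state that is bounded by the trace, so each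
   replacement raises a winning probability by at most the trace of the positive
   part of the difference of two states of trace 1, which is half its trace
   norm, hence by at most eps.  Once all keys are uniform and independent of E,
   shifting all the keys of a path by the same amount changes neither the
   answers of Relay nor, as long as the path is not in T, those of Corrupt.  The
   shift therefore hides the share of every path outside the final T, and
   confidentiality makes the guess independent of b.  The lower bound is the
   upper bound for the adversary with the opposite guess. *)

Require Import Defs.
From mathcomp Require Import all_boot all_order all_algebra.
From mathcomp Require Import ring.
From mathcomp.real_closed Require Import mxtens.

Set Implicit Arguments.
Unset Strict Implicit.
Unset Printing Implicit Defensive.

Import Order.TTheory GRing.Theory Num.Theory.
Local Open Scope ring_scope.
Local Open Scope sesquilinear_scope.

(** * Positive semidefinite matrices and the trace norm *)

Section Psd.
Variable C : numClosedFieldType.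

Lemma adjmxM m n p (A : 'M[C]_(m, n)) (B : 'M[C]_(n, p)) :
  (A *m B)^t* = B^t* *m A^t*.
Proof. by rewrite trmx_mul map_mxM. Qed.

Lemma adjmxB m n (A B : 'M[C]_(m, n)) : (A - B)^t* = A^t* - B^t*.
Proof. by apply/matrixP => i j; rewrite !mxE rmorphB. Qed.

Lemma adjmx_sum (I : finType) (P : pred I) m n (F : I -> 'M[C]_(m, n)) :
  (\sum_(i | P i) F i)^t* = \sum_(i | P i) (F i)^t*.
Proof.
apply/matrixP => i j; rewrite !mxE !summxE rmorph_sum.
by apply: eq_bigr => k _; rewrite !mxE.
Qed.

Lemma adj_delta_mx m n (i : 'I_m) (j : 'I_n) :
  (delta_mx i j : 'M[C]_(m, n))^t* = delta_mx j i.
Proof. by apply/matrixP => k l; rewrite !mxE rmorph_nat andbC. Qed.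

Lemma psdmx_sum (I : finType) (P : pred I) d (F : I -> 'M[C]_d) :
  (forall i, P i -> psdmx (F i)) -> psdmx (\sum_(i | P i) F i).
Proof.
move=> hF v; rewrite mulmx_sumr mulmx_suml summxE.
by apply: sumr_ge0 => i Pi; apply: hF.
Qed.

Lemma psdmxZ d (c : C) (A : 'M[C]_d) : 0 <= c -> psdmx A -> psdmx (c *: A).
Proof.
by move=> hc hA v; rewrite -scalemxAr -scalemxAl mxE mulr_ge0 ?hA.
Qed.

Lemma psdmx_conj d d' (K : 'M[C]_(d', d)) (A : 'M[C]_d) :
  psdmx A -> psdmx (K *m A *m K^t*).
Proof.
by move=> hA v; have := hA (v *m K); rewrite adjmxM !mulmxA.
Qed.

Lemma psdmx_diag d (D : 'rV[C]_d) : (forall i, 0 <= D 0 i) -> psdmx (diag_mx D).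
Proof.
move=> hD v; rewrite mul_mx_diag mxE sumr_ge0 // => i _.
by rewrite !mxE mulrAC mulr_ge0 // mul_conjC_ge0.
Qed.

(** The quadratic form at e_i + c e_j. Varying [c] gives access to the off-diagonal entries. *)
Lemma psdmx_entry d (A : 'M[C]_d) (i j : 'I_d) (c : C) : psdmx A ->
  0 <= A i i + c^* * A i j + c * A j i + c * c^* * A j j.
Proof.
move=> /(_ (delta_mx 0 i + c *: delta_mx 0 j)); congr (0 <= _).
have -> : (delta_mx 0 i + c *: delta_mx 0 j : 'rV[C]_d)^t*
    = delta_mx i 0 + c^* *: delta_mx j 0.
  by apply/matrixP => k l; rewrite !mxE rmorphD rmorphM !rmorph_nat ord1 /= !andbT.
have entryE k l : (delta_mx 0 k *m A *m delta_mx l (0 : 'I_1)) (0 : 'I_1) 0 = A k l.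
  by rewrite -rowE -colE !mxE.
rewrite !(mulmxDl, mulmxDr) -!scalemxAl -!scalemxAr.
have addE (M M' : 'M[C]_1) : (M + M') 0 0 = M 0 0 + M' 0 0 by rewrite mxE.
have scaleE (a : C) (M : 'M[C]_1) : (a *: M) 0 0 = a * M 0 0 by rewrite mxE.
by rewrite !addE !scaleE !entryE; ring.
Qed.

Lemma psdmx_diag_ge0 d (A : 'M[C]_d) i : psdmx A -> 0 <= A i i.
Proof.
by move=> hA; have := psdmx_entry i i 0 hA; rewrite conjC0 !mul0r !addr0.
Qed.

Lemma psdmx_tr_ge0 d (A : 'M[C]_d) : psdmx A -> 0 <= \tr A.
Proof. by move=> hA; apply: sumr_ge0 => i _; apply: psdmx_diag_ge0. Qed.

Lemma psdmx_adj d (A : 'M[C]_d) : psdmx A -> A^t* = A.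
Proof.
move=> hA; apply/matrixP => i j; rewrite !mxE.
have real_diag k : A k k \is Num.real by rewrite ger0_real ?psdmx_diag_ge0.
have real_form c : c^* * A j i + c * A i j \is Num.real.
  have -> : c^* * A j i + c * A i j =
      (A j j + c^* * A j i + c * A i j + c * c^* * A i i)
      - c * c^* * A i i - A j j by ring.
  have norm_real : c * c^* \is Num.real by rewrite ger0_real ?mul_conjC_ge0.
  rewrite !rpredB ?(rpredM norm_real) ?real_diag //.
  exact/ger0_real/psdmx_entry.
(* Polarization: [c = 1] makes A_ij + A_ji real and [c = 'i] makes ['i] times A_ij - A_ji real;
   together they say that A_ij is the conjugate of A_ji. *)
have := real_form 1; rewrite conjC1 !mul1r => /CrealP; rewrite rmorphD => e1.
have conji : ('i : C)^* = - 'i := conjCi C.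
have := real_form 'i; rewrite conji => /CrealP.
rewrite rmorphD !rmorphM rmorphN /= conji => e2.
have i_neq0 := neq0Ci C.
have e3 : (A j i)^* - (A i j)^* = A i j - A j i.
  apply: (mulfI i_neq0); apply: etrans (etrans e2 _); ring.
have : 2 * (A j i)^* = 2 * A i j.
  have -> : 2 * (A j i)^* = (A j i)^* + (A i j)^* + ((A j i)^* - (A i j)^*) by ring.
  by rewrite e1 e3; ring.
by apply: mulfI; rewrite pnatr_eq0.
Qed.

(** Two unitary diagonalizations of one matrix give the same characteristic polynomial, hence the
    same roots with multiplicity. Equality up to a permutation suffices for the sum in
    [trace_norm]. *)
Lemma spectral_diag_unitary_diag d (M : 'M[C]_d) (D : 'rV[C]_d) :
    M \is unitarymx ->
  perm_eq [seq spectral_diag (M^t* *m diag_mx D *m M) 0 i | i : 'I_d]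
          [seq D 0 i | i : 'I_d].
Proof.
have char_poly_sim (P A : 'M[C]_d) (E : 'rV[C]_d) : P \is unitarymx ->
    A = P^t* *m diag_mx E *m P -> char_poly A = \prod_(i < d) ('X - (E 0 i)%:P).
  move=> hP ->; transitivity (char_poly (diag_mx E)); last first.
    rewrite char_poly_trig ?diag_mx_is_trig //.
    by apply: eq_bigr => i _; rewrite mxE eqxx.
  have hP' : map_mx polyC P *m map_mx polyC (P^t*) = 1%:M.
    by rewrite -map_mxM (unitarymxP hP) map_mx1.
  rewrite /char_poly /char_poly_mx.
  have -> : 'X%:M - map_mx polyC (P^t* *m diag_mx E *m P) =
      map_mx polyC (P^t*) *m ('X%:M - map_mx polyC (diag_mx E)) *m map_mx polyC P.
    rewrite mulmxBr mulmxBl !map_mxM; congr (_ - _).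
    by rewrite scalar_mxC -mulmxA (mulmx1C hP') mulmx1.
  by rewrite !det_mulmx mulrC mulrA -det_mulmx hP' det1 mul1r.
move=> hM; set A := _ *m M.
have normA : A \is normalmx.
  apply/normalmxP; rewrite /A !adjmxM trmxCK.
  have D_adj : (diag_mx D)^t* = diag_mx (\row_i (D 0 i)^*).
    apply/matrixP => i j; rewrite !mxE rmorphMn /= eq_sym.
    by case: eqP => [->|].
  rewrite D_adj !mulmxA; congr (_ *m M).
  rewrite -!mulmxA !(mulmxA M) (unitarymxP hM) !mul1mx.
  by rewrite !mulmx_diag; congr (_ *m diag_mx _); apply/rowP => i; rewrite !mxE mulrC.
apply: prod_XsubC_eq; rewrite !big_image /=.
have /orthomx_spectralP := normA.
rewrite invmx_unitary ?spectral_unitarymx // => /char_poly_sim <-.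
  by rewrite (char_poly_sim M A D).
exact: spectral_unitarymx.
Qed.

(* The witness is the positive part of A, whose trace is (tr A + |A|_1) / 2. *)
Lemma hermitian_positive_part d (A : 'M[C]_d) : A^t* = A ->
  exists P : 'M[C]_d, [/\ psdmx P, psdmx (P - A) &
    \tr P = 2^-1 * (\tr A + trace_norm A)].
Proof.
move=> hA; pose U := spectralmx A; pose D := spectral_diag A.
have hU : U \is unitarymx by apply: spectral_unitarymx.
have herm : A \is hermsymmx by apply/is_hermitianmxP; rewrite expr0 scale1r hA.
have D_real i : D 0 i \is Num.real.
  by have /mxOverP := hermitian_spectral_diag_real herm; apply.
have eA : A = U^t* *m diag_mx D *m U.
  have /orthomx_spectralP := hermitian_normalmx herm.
  by rewrite invmx_unitary.
pose E := \row_i `|D 0 i| : 'rV[C]_d.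
have psd_diag (F : 'rV[C]_d) : (forall i, 0 <= F 0 i) ->
    psdmx (U^t* *m diag_mx F *m U).
  move=> hF; rewrite -{2}[U]trmxCK; apply: psdmx_conj; exact: psdmx_diag.
have tr_diag (F : 'rV[C]_d) : \tr (U^t* *m diag_mx F *m U) = \sum_i F 0 i.
  by rewrite mxtrace_mulC mulmxA (unitarymxP hU) mul1mx mxtrace_diag.
exists (U^t* *m diag_mx (2^-1 *: (D + E)) *m U); split.
- apply: psd_diag => i; rewrite !mxE mulr_ge0 ?invr_ge0 ?ler0n //.
  by rewrite -lerBlDl sub0r lerNl; apply: real_lerNnormlW.
- rewrite {1}eA -mulmxBl -mulmxBr -linearB /=; apply: psd_diag => i; rewrite !mxE.
  have -> : 2^-1 * (D 0 i + `|D 0 i|) - D 0 i = 2^-1 * (`|D 0 i| - D 0 i) by field.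
  by rewrite mulr_ge0 ?invr_ge0 ?ler0n // subr_ge0 real_ler_norm.
rewrite tr_diag {1}eA tr_diag /trace_norm hA.
(* The square of [A] has the eigenvalues D_i^2, so the trace norm is the sum of their roots
   |D_i|. *)
have -> : A *m A = U^t* *m diag_mx (\row_i (D 0 i ^+ 2)) *m U.
  rewrite {1 2}eA -!mulmxA (mulmxA U) (unitarymxP hU) mul1mx.
  rewrite (mulmxA (diag_mx D)) mulmx_diag; congr (_ *m (_ *m _)); congr diag_mx.
have -> (F : 'rV[C]_d) : \sum_i sqrtC (F 0 i)
    = \sum_(x <- [seq F 0 i | i : 'I_d]) sqrtC x by rewrite big_image.
rewrite (perm_big _ (spectral_diag_unitary_diag _ hU)) /= big_image /=.
rewrite -big_split mulr_sumr; apply: eq_bigr => i _; rewrite !mxE.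
by rewrite -real_normK ?sqrCK ?normr_ge0.
Qed.

End Psd.

(** * Replacing keys by uniform ones *)

Section Effects.
Variable C : numClosedFieldType.

(** These are the functionals A -> tr (M A) with 0 <= M <= 1, that is, single outcomes of a
    measurement. The axioms avoid writing down M for an adaptive strategy. *)
Record effect d (F : 'M[C]_d -> C) : Prop := Effect {
  effect_linear : forall a A B, F (a *: A + B) = a * F A + F B;
  effect_ge0 : forall A, psdmx A -> 0 <= F A;
  effect_le_tr : forall A, psdmx A -> F A <= \tr A }.

Section Basic.
Variables (d : nat) (F : 'M[C]_d -> C).
Hypothesis hF : effect F.

Lemma effect0 : F 0 = 0.
Proof. by have := effect_linear hF (-1) 0 0; rewrite scaler0 addr0 mulN1r addNr. Qed.

Lemma effectD A B : F (A + B) = F A + F B.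
Proof. by rewrite -[A]scale1r (effect_linear hF) scale1r mul1r. Qed.

Lemma effectZ a A : F (a *: A) = a * F A.
Proof. by rewrite -[a *: A]addr0 (effect_linear hF) effect0 addr0. Qed.

Lemma effectB A B : F (A - B) = F A - F B.
Proof. by rewrite -[- B]scaleN1r effectD effectZ mulN1r. Qed.

Lemma effect_sum (I : Type) (r : seq I) (P : pred I) (A : I -> 'M[C]_d) :
  F (\sum_(i <- r | P i) A i) = \sum_(i <- r | P i) F (A i).
Proof. exact: (big_morph F effectD effect0). Qed.

End Basic.

Lemma effect_mix d (I : finType) (p : I -> C) (F : I -> 'M[C]_d -> C) :
    (forall i, 0 <= p i) -> \sum_i p i = 1 -> (forall i, effect (F i)) ->
  effect (fun A => \sum_i p i * F i A).
Proof.
move=> p_ge0 p_sum1 hF; split=> [a A B|A hA|A hA].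
- rewrite mulr_sumr -big_split; apply: eq_bigr => i _ /=.
  by rewrite (effect_linear (hF i)) mulrDr mulrCA.
- by apply: sumr_ge0 => i _; rewrite mulr_ge0 ?(effect_ge0 (hF i)).
- rewrite -[leRHS]mul1r -p_sum1 mulr_suml; apply: ler_sum => i _.
  by rewrite ler_wpM2l ?(effect_le_tr (hF i)).
Qed.

End Effects.

Section Randomization.
Variables (C : numClosedFieldType) (I : finType) (Y : finZmodType).

Local Notation keys := {ffun I -> Y}.

Definition single_key (e : I) (a : Y) : keys := [ffun e' => if e' == e then a else 0].

Definition randomize d (e : I) (w : keys -> 'M[C]_d) (k : keys) : 'M[C]_d :=
  #|Y|%:R^-1 *: \sum_a w (k + single_key e a).

Lemma single_keyD e a b : single_key e (a + b) = single_key e a + single_key e b.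
Proof. by apply/ffunP => i; rewrite !ffunE; case: eqP; rewrite ?addr0. Qed.

Lemma sum_single_key (k : keys) : \sum_e single_key e (k e) = k.
Proof.
apply/ffunP => i; rewrite sum_ffunE (bigD1 i) //= ffunE eqxx big1 ?addr0 // => j.
by rewrite ffunE eq_sym => /negbTE->.
Qed.

Lemma sum_shift (V : nmodType) (g : keys -> V) (h : keys) :
  \sum_(k : keys) g (k + h) = \sum_k g k.
Proof.
have inj : injective (fun k : keys => k + h) by apply: addIr.
by rewrite [RHS](reindex_inj inj).
Qed.

Lemma card_key_neq0 : #|Y|%:R != 0 :> C.
Proof. by rewrite pnatr_eq0 -lt0n; apply/card_gt0P; exists 0. Qed.

Lemma randomize_psd d e (w : keys -> 'M[C]_d) :
  (forall k, psdmx (w k)) -> forall k, psdmx (randomize e w k).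
Proof.
by move=> hw k; apply: psdmxZ; rewrite ?invr_ge0 ?ler0n //; apply: psdmx_sum.
Qed.

(** Moves the averaging from the state to the test: on the right, an average of effects, again an
    effect, is applied to the original [w]. *)
Lemma sum_effect_randomize d e (w : keys -> 'M[C]_d) (F : keys -> 'M[C]_d -> C) :
    (forall k, effect (F k)) ->
  \sum_k F k (randomize e w k) =
  \sum_(k : keys) \sum_a #|Y|%:R^-1 * F (k - single_key e a) (w k).
Proof.
move=> hF; under eq_bigr do rewrite /randomize effectZ // effect_sum // mulr_sumr.
rewrite exchange_big [RHS]exchange_big; apply: eq_bigr => a _ /=.
rewrite -(sum_shift _ (- single_key e a)).
by apply: eq_bigr => k _; rewrite subrK.
Qed.

Lemma sum_tr_randomize d e (w : keys -> 'M[C]_d) :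
  \sum_k \tr (randomize e w k) = \sum_k \tr (w k).
Proof.
under eq_bigr do rewrite mxtraceZ raddf_sum /=.
rewrite -mulr_sumr exchange_big /=.
under eq_bigr do rewrite (sum_shift (fun k => \tr (w k))).
by rewrite sumr_const -[X in _ * X]mulr_natl mulKf ?card_key_neq0.
Qed.

Lemma randomize_invariant d e (w : keys -> 'M[C]_d) k b :
  randomize e w (k + single_key e b) = randomize e w k.
Proof.
congr (_ *: _); rewrite [RHS](reindex_inj (addrI b)) /=.
by apply: eq_bigr => a _; rewrite single_keyD addrA.
Qed.

Lemma randomize_keeps_invariant d e e' (w : keys -> 'M[C]_d) :
    (forall k b, w (k + single_key e b) = w k) ->
  forall k b, randomize e' w (k + single_key e b) = randomize e' w k.
Proof.
by move=> hw k b; congr (_ *: _); apply: eq_bigr => a _; rewrite addrAC hw.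
Qed.

Definition randomize_seq d (es : seq I) (w : keys -> 'M[C]_d) : keys -> 'M[C]_d :=
  foldr (@randomize d) w es.

Lemma randomize_seq_psd d es (w : keys -> 'M[C]_d) :
  (forall k, psdmx (w k)) -> forall k, psdmx (randomize_seq es w k).
Proof. by move=> hw; elim: es => //= e es; apply: randomize_psd. Qed.

Lemma sum_tr_randomize_seq d es (w : keys -> 'M[C]_d) :
  \sum_k \tr (randomize_seq es w k) = \sum_k \tr (w k).
Proof. by elim: es => //= e es <-; apply: sum_tr_randomize. Qed.

Lemma randomize_seq_invariant d es (w : keys -> 'M[C]_d) e : e \in es ->
  forall k b, randomize_seq es w (k + single_key e b) = randomize_seq es w k.
Proof.
elim: es => //= e' es IH; rewrite inE => /orP[/eqP->|/IH].
  exact: randomize_invariant.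
exact: randomize_keeps_invariant.
Qed.

(** Every key assignment is a sum of single-key shifts, and each of these fixes the state once its
    key has been randomized. The constant state describes uniform keys independent of E. *)
Lemma randomize_all_const d (w : keys -> 'M[C]_d) k :
  randomize_seq (enum I) w k = randomize_seq (enum I) w 0.
Proof.
rewrite -[k]sum_single_key; elim/big_rec: _ => //= e k' _ <-.
by rewrite addrC randomize_seq_invariant // mem_enum.
Qed.

End Randomization.

(** * Trace distance and the replacement of one key *)

Section TraceDistance.
Variables (C : numClosedFieldType) (I : finType) (Y : finZmodType) (d : nat).
Variable e : I.

Local Notation keys := {ffun I -> Y}.
Local Notation others := {ffun {e' : I | e' != e} -> Y}.

Definition key_index (k : keys) (i : 'I_d) : 'I_(#|Y| * (#|{: others}| * d)) :=
  mxtens_index (enum_rank (k e), mxtens_index (enum_rank (other_keys e k), i)).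

(** The compression to the classical value [k]. On a classical-quantum state it returns the
    component at [k]; on any operator, such as a positive part, it preserves positivity and, summed
    over [k], the trace. *)
Definition key_block (B : 'M[C]_(#|Y| * (#|{: others}| * d))) (k : keys) : 'M[C]_d :=
  mxsub (key_index k) (key_index k) B.

Lemma psdmx_mxsub m m' (f : 'I_m -> 'I_m') (B : 'M[C]_m') :
  psdmx B -> psdmx (mxsub f f B).
Proof.
have -> : mxsub f f B = rowsub f 1%:M *m B *m (rowsub f 1%:M)^t*.
  have -> : (rowsub f 1%:M)^t* = colsub f 1%:M :> 'M[C]_(m', m).
    by apply/matrixP => i j; rewrite !mxE rmorph_nat eq_sym.
  rewrite mul_rowsub_mx mul1mx mulmx_colsub mulmx1.
  by apply/matrixP => i j; rewrite !mxE.
exact: psdmx_conj.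
Qed.

Lemma other_keys_inj (k k' : keys) :
  k e = k' e -> other_keys e k = other_keys e k' -> k = k'.
Proof.
move=> eq_e eq_o; apply/ffunP => e'; have [->//|ne] := eqVneq e' e.
by have /ffunP/(_ (exist _ e' ne)) := eq_o; rewrite !ffunE.
Qed.

Lemma other_keys_shift (k : keys) a :
  other_keys e (k + single_key e a) = other_keys e k.
Proof.
by apply/ffunP => e'; rewrite !ffunE (negbTE (valP e')) addr0.
Qed.

Lemma mxtrace_key_block B : \sum_k \tr (key_block B k) = \tr B.
Proof.
pose h (p : keys * 'I_d) := key_index p.1 p.2.
have h_inj : injective h.
  move=> [k i] [k' i'] /(congr1 (@mxtens_unindex _ _)).
  rewrite !mxtens_indexK => eq_h; have /enum_rank_inj eq_e := congr1 fst eq_h.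
  have := congr1 (@mxtens_unindex _ _ \o snd) eq_h.
  rewrite /= !mxtens_indexK => -[/enum_rank_inj eq_o ->].
  by move: (other_keys_inj eq_e eq_o) => /= ->.
have h_bij : bijective h.
  (* Counting: |Y| * |Y|^(|I|-1) * d = |Y|^|I| * d, where |I| > 0 because of [e]. *)
  apply: inj_card_bij => //; rewrite card_prod !card_ord !card_ffun mulnA.
  rewrite -expnS card_sig (@eq_card _ _ (predC1 e)) // cardC1 prednK //.
  by apply/card_gt0P; exists e.
rewrite [RHS](reindex h) /=; last exact: onW_bij.
rewrite [RHS](eq_bigr (fun p => key_block B p.1 p.2 p.2)); last first.
  by move=> p _; rewrite mxE.
by rewrite -(pair_bigA _ (fun k i => key_block B k i i)).
Qed.

Lemma ketbra_diagE (X : finType) (x y : X) :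
  ketbra C x (enum_rank y) (enum_rank y) = (y == x)%:R.
Proof. by rewrite mxE andbb (inj_eq enum_rank_inj). Qed.

Variable w : keys -> 'M[C]_d.

Lemma key_block_joint k : key_block (cq_mx (key_and_rest w e)) k = w k.
Proof.
apply/matrixP => i j; rewrite mxE summxE (bigD1 (k e)) //= [X in _ + X]big1.
  rewrite tensmxE ketbra_diagE eqxx mul1r addr0 summxE (bigD1 k) //= big1.
    by rewrite tensmxE ketbra_diagE eqxx mul1r addr0.
  move=> k' /andP[/eqP eq_e ne]; rewrite tensmxE ketbra_diagE.
  case: eqP => [eq_o|]; last by rewrite mul0r.
  by rewrite (other_keys_inj eq_e (esym eq_o)) eqxx in ne.
by move=> x; rewrite tensmxE ketbra_diagE eq_sym => /negbTE->; rewrite mul0r.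
Qed.

Lemma key_block_ideal k :
  key_block (uniform_mx C Y *t quantum_marginal (key_and_rest w e)) k
    = randomize e w k.
Proof.
apply/matrixP => i j; rewrite mxE tensmxE [RHS]mxE; congr (_ * _).
  rewrite summxE (bigD1 (k e)) //= mxE ketbra_diagE eqxx mulr1 big1 ?addr0 // => x.
  by rewrite eq_sym mxE ketbra_diagE => /negbTE->; rewrite mulr0.
(* Only assignments agreeing with [k] outside [e] contribute; they are the shifts of [k] at [e] by
   [a = k' e - k e]. *)
transitivity (\sum_(k' | other_keys e k' == other_keys e k) w k' i j).
  rewrite [RHS]big_mkcond [RHS](partition_big (fun k' : keys => k' e) xpredT) //= summxE.
  apply: eq_bigr => x _; rewrite summxE; apply: eq_bigr => k' _.
  by rewrite tensmxE ketbra_diagE eq_sym; case: eqP => _; rewrite ?mul1r ?mul0r.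
rewrite summxE (reindex_onto (fun a => k + single_key e a) (fun k' => k' e - k e)) /=.
  apply: eq_bigl => a; rewrite other_keys_shift eqxx /=.
  by rewrite !ffunE eqxx addrC addKr eqxx.
move=> k' /eqP eq_o; apply: other_keys_inj.
  by rewrite !ffunE eqxx addrC subrK.
by rewrite other_keys_shift.
Qed.

(** The effects [F k] together act as one test on the joint state of key, other keys and E. With P
    the positive part of [rho - sigma], each [F k] is at most the trace of the block of P at [k],
    and these traces sum to tr P. *)
Lemma randomize_distinguish (F : keys -> 'M[C]_d -> C) (eps : C) :
    (forall k, psdmx (w k)) -> (forall k, effect (F k)) ->
    eps_private eps (key_and_rest w e) ->
  \sum_k F k (w k) - \sum_k F k (randomize e w k) <= eps.
Proof.
move=> hw hF; apply: le_trans; set rho := cq_mx _; set sigma := _ *t _.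
have rho_adj : rho^t* = rho.
  rewrite adjmx_sum; apply: eq_bigr => x _.
  rewrite trmx_tens map_mxT adj_delta_mx; congr (_ *t _).
  rewrite adjmx_sum; apply: eq_bigr => k _.
  by rewrite trmx_tens map_mxT adj_delta_mx psdmx_adj.
have sigma_adj : sigma^t* = sigma.
  rewrite trmx_tens map_mxT; congr (_ *t _).
    rewrite adjmx_sum; apply: eq_bigr => x _.
    rewrite linearZ map_mxZ adj_delta_mx.
    by rewrite fmorphV rmorph_nat.
  rewrite adjmx_sum; apply: eq_bigr => x _.
  rewrite adjmx_sum; apply: eq_bigr => k _.
  by rewrite trmx_tens map_mxT adj_delta_mx psdmx_adj.
have [P [P_psd PB_psd tr_P]] : exists P, [/\ psdmx P, psdmx (P - (rho - sigma)) &
    \tr P = 2^-1 * (\tr (rho - sigma) + trace_norm (rho - sigma))].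
  by apply: hermitian_positive_part; rewrite adjmxB rho_adj sigma_adj.
have blockB A B k : key_block (A - B) k = key_block A k - key_block B k.
  by apply/matrixP => i j; rewrite !mxE.
(* Equal traces make tr P exactly half the trace norm, the quantity bounded in [eps_private]. *)
have tr0 : \tr (rho - sigma) = 0.
  rewrite -mxtrace_key_block.
  under eq_bigr do rewrite blockB key_block_joint key_block_ideal linearB /=.
  by rewrite sumrB sum_tr_randomize subrr.
rewrite tr0 add0r in tr_P; rewrite -tr_P -mxtrace_key_block -sumrB.
apply: ler_sum => k _.
rewrite -(effectB (hF k)) -{1}key_block_joint -key_block_ideal -blockB.
apply: (@le_trans _ _ (F k (key_block P k))); last first.
  by apply: (effect_le_tr (hF k)); apply: psdmx_mxsub.
rewrite -subr_ge0 -(effectB (hF k)) -blockB.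
by apply: (effect_ge0 (hF k)); apply: psdmx_mxsub.
Qed.

End TraceDistance.

(** A hybrid argument. The outermost randomization is absorbed into the test, so privacy is only
    ever applied to the original [w]; this is why [F] is generalized in the induction. *)
Lemma randomize_seq_distinguish (C : numClosedFieldType) (I : finType)
    (Y : finZmodType) d (es : seq I) (w : {ffun I -> Y} -> 'M[C]_d)
    (F : {ffun I -> Y} -> 'M[C]_d -> C) (eps : C) :
    (forall k, psdmx (w k)) -> (forall k, effect (F k)) ->
    (forall e, eps_private eps (key_and_rest w e)) ->
  \sum_k F k (w k) - \sum_k F k (randomize_seq es w k) <= (size es)%:R * eps.
Proof.
move=> hw hF hpriv; elim: es F hF => [|e es IH] F hF /=; first by rewrite subrr mul0r.
rewrite -(subrK (\sum_k F k (randomize e w k)) (\sum_k F k (w k))).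
rewrite -addrA mulrSr mulrDl mul1r addrC lerD //; last exact: randomize_distinguish.
rewrite !sum_effect_randomize //; 
apply: (IH (fun k A => \sum_a #|Y|%:R^-1 * F (k - single_key e a) A)) => k.
apply: effect_mix => // [a|]; first by rewrite invr_ge0 ler0n.
by rewrite sumr_const -[LHS]mulr_natl mulfV ?card_key_neq0.
Qed.

(** * The relay game *)

Section Runs.
Variables (C : numClosedFieldType) (n : nat) (Y : finZmodType).
Variable N : repeater_network n.

Local Notation keys := {ffun edge N -> Y}.

(** For fixed keys the oracle answers are classical and leave [rho] alone; only instruments act on
    it, and they preserve positivity and total trace. *)
Lemma run_effect (q : keys) ev d (A : strategy C Y N d) R T :
  effect (run q ev A R T).
Proof.
elim: A R T => {d} [d b|d v c next IH|d v next IH|d m d' K complete next IH] R T /=.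
- split=> [a A B|A hA|A hA]; case: ifP => _ //.
  + by rewrite mxtraceD mxtraceZ.
  + by rewrite mulr0 addr0.
  + exact: psdmx_tr_ge0.
  + exact: psdmx_tr_ge0.
- by case: (v \in R).
- by case: (v \in R).
split=> [a A B|A hA|A hA].
- rewrite mulr_sumr -big_split; apply: eq_bigr => o _ /=.
  by rewrite -(effect_linear (IH o R T)) mulmxDr mulmxDl -scalemxAr -scalemxAl.
- by apply: sumr_ge0 => o _; apply/(effect_ge0 (IH o R T))/psdmx_conj.
- rewrite -[A in \tr A]mul1mx -complete mulmx_suml raddf_sum; apply: ler_sum => o _ /=.
  have <- : \tr (K o *m A *m (K o)^t*) = \tr ((K o)^t* *m K o *m A).
    by rewrite mxtrace_mulC mulmxA.
  by apply: (effect_le_tr (IH o R T)); apply: psdmx_conj.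
Qed.

(** A run is additive in the indicator of its event. This serves to split by the final T and by the
    guess. *)
Lemma run_split (J : finType) (P : pred J) (q : keys)
    (ev : bool -> {set 'I_n} -> bool) (evs : J -> bool -> {set 'I_n} -> bool) d
    (A : strategy C Y N d) R T rho :
    (forall b T', (ev b T')%:R = \sum_(j | P j) (evs j b T')%:R :> C) ->
  run q ev A R T rho = \sum_(j | P j) run q (evs j) A R T rho.
Proof.
move=> hev.
elim: A R T rho => {d}
  [d b|d v c next IH|d v next IH|d m d' K complete next IH] R T rho /=.
- have ifE (x : bool) : (if x then \tr rho else 0) = x%:R * \tr rho.
    by case: x; rewrite ?mul1r ?mul0r.
  by rewrite ifE hev mulr_suml; apply: eq_bigr => j _; rewrite ifE.
- by case: (v \in R); apply: IH.
- by case: (v \in R); apply: IH.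
- by rewrite exchange_big; apply: eq_bigr => o _; apply: IH.
Qed.

Section FinalSet.
Variables (ev : bool -> {set 'I_n} -> bool) (T0 : {set 'I_n}).
Hypothesis ev_final : forall b T, ev b T -> T = T0.

(** T only grows, so a run that has left the subsets of [T0] cannot end in [T0]. Fixing the final
    set in advance tells from the start which paths stay uncorrupted. *)
Lemma run_out (q : keys) d (A : strategy C Y N d) R (T : {set 'I_n}) rho :
  ~~ (T \subset T0) -> run q ev A R T rho = 0.
Proof.
elim: A R T rho => {d}
  [d b|d v c next IH|d v next IH|d m d' K complete next IH] R T rho hT /=.
- by case: ifP => // /ev_final eT; rewrite eT subxx in hT.
- by case: ifP => _; apply: IH.
- case: ifP => _; apply: IH => //.
  by apply: contra hT; apply: subset_trans; apply: subsetUr.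
- by rewrite big1 // => o _; apply: IH.
Qed.

Definition path_const (a : {ffun 'I_n -> Y}) : keys := [ffun e => a (tag e)].

(* Relaying only reveals differences of consecutive keys of a path, and
   corruption puts the path into T. *)
Lemma run_shift (a : {ffun 'I_n -> Y}) (q : keys) d (A : strategy C Y N d) R T rho :
    (forall i, i \in T0 -> a i = 0) ->
  run (q + path_const a) ev A R T rho = run q ev A R T rho.
Proof.
move=> ha.
elim: A R T rho => {d}
  [d b|d v c next IH|d v next IH|d m d' K complete next IH] R T rho //=.
- case: ifP => _; rewrite IH //; congr (run _ _ (next (Some _)) _ _ _).
  by rewrite !ffunE /= opprD (addrA c) addrACA addNr addr0.
- case: ifP => _; first exact: IH.
  (* On a path of [T0] the shift is zero; corrupting any other path makes both runs contribute 0. *)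
  have [vT0|vT0] := boolP (tag v \in T0).
    by rewrite !ffunE /= ha // !addr0 IH.
  by rewrite !run_out // subUset sub1set negb_and vT0.
- by apply: eq_bigr => o _; apply: IH.
Qed.

Lemma uniform_keys_hide_shares (y y' : {ffun 'I_n -> Y}) d
    (f : {ffun 'I_n -> Y} -> strategy C Y N d) rho :
    (forall i, i \in T0 -> y i = y' i) ->
  \sum_(q : keys) run q ev (f (first_ciphertexts y q)) set0 set0 rho =
  \sum_(q : keys) run q ev (f (first_ciphertexts y' q)) set0 set0 rho.
Proof.
(* Shifting the keys by [y - y'] turns the ciphertexts of [y'] into those of [y]; as [rho] does not
   depend on the keys, reindexing the sum is free. *)
move=> hy; pose a := y - y'.
rewrite -[RHS](sum_shift _ (path_const a)); apply: eq_bigr => q _.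
rewrite run_shift => [|i iT0]; last by rewrite !ffunE hy // subrr.
congr (run _ _ (f _) _ _ _); apply/ffunP => i; rewrite !ffunE /=.
by rewrite addrCA [y' i + _]addrC subrK addrC.
Qed.

End FinalSet.
End Runs.

(** * Confidentiality of the encoded shares *)

Section SecretSharingHiding.
Variables (C : numClosedFieldType) (n : nat) (Y G : finZmodType).
Variables (Q : {set {set 'I_n}}) (Share : G -> dist C {ffun 'I_n -> Y}).
Hypothesis hconf : perfectly_confidential Q Share.

(** Share vectors are grouped by their view on [T0]: [H] is constant on each class, and
    confidentiality gives each class the same probability under [g] and [g']. *)
Lemma confidential_expectation (T0 : {set 'I_n}) (H : {ffun 'I_n -> Y} -> C) g g' :
    T0 \notin Q ->
    (forall y y' : {ffun 'I_n -> Y}, (forall i, i \in T0 -> y i = y' i) -> H y = H y') ->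
  \sum_y Share g y * H y = \sum_y Share g' y * H y.
Proof.
move=> T0Q hH.
rewrite (partition_big (Defs.mask T0) xpredT) //=.
rewrite [RHS](partition_big (Defs.mask T0) xpredT) //=.
apply: eq_bigr => v _.
have [y0 /eqP hy0|none] := pickP [pred y | Defs.mask T0 y == v]; last first.
  by rewrite !big_pred0.
have HE y : Defs.mask T0 y == v -> H y = H y0.
  move=> /eqP hy; apply: hH => i iT0.
  have /ffunP/(_ i) : Defs.mask T0 y = Defs.mask T0 y0 by rewrite hy.
  by rewrite !ffunE iT0 => -[].
have PrE h : \sum_(y | Defs.mask T0 y == v) Share h y * H y
    = Pr (Share h) [pred y | Defs.mask T0 y == v] * H y0.
  by rewrite mulr_suml; apply: eq_bigr => y /HE ->.
by rewrite !PrE (hconf g g').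
Qed.

Variables (S : finType) (Encode : S -> dist C G).

(** Conditioned on any codeword, the expectation equals that of the fixed secret 0, so the
    distribution of the codeword drops out. *)
Lemma encoded_expectation (T0 : {set 'I_n}) (H : {ffun 'I_n -> Y} -> C) s s' :
    T0 \notin Q ->
    (forall y y' : {ffun 'I_n -> Y}, (forall i, i \in T0 -> y i = y' i) -> H y = H y') ->
  \sum_y dbind (Encode s) Share y * H y = \sum_y dbind (Encode s') Share y * H y.
Proof.
move=> T0Q hH.
suff eqH r : \sum_y dbind (Encode r) Share y * H y = \sum_y Share 0 y * H y.
  by rewrite !eqH.
under eq_bigr do rewrite ffunE mulr_suml.
rewrite exchange_big /= -[RHS]mul1r -(pmf_sum1 (Encode r)) mulr_suml.
apply: eq_bigr => g _; rewrite -(confidential_expectation g 0 T0Q hH) mulr_sumr.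
by apply: eq_bigr => y _; rewrite mulrA.
Qed.

End SecretSharingHiding.

(** * The game with ideal and with real keys *)

Section Game.
Variables (C : numClosedFieldType) (n : nat) (Y G : finZmodType) (S : finType).
Variables (N : repeater_network n) (d : nat).

Local Notation keys := {ffun edge N -> Y}.

Section GameEffect.
Variables (Pi : relay_protocol C n Y S) (A : adversary C Y S N d).

(** The share of one key assignment in the game. With the sum over keys outermost, the game has the
    form required by [randomize_seq_distinguish]. *)
Definition game_effect (ev : bool -> bool -> {set 'I_n} -> bool) (q : keys)
    (rho : 'M[C]_d) : C :=
  \sum_(b : bool) 2^-1 *
  \sum_(z : S * S * adv_state A) adv_choose A z *
  \sum_(y : {ffun 'I_n -> Y})
    protocol_share Pi (if b then z.1.2 else z.1.1) y *
    run q (ev b) (adv_attack z.2 (first_ciphertexts y q)) set0 set0 rho.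

Lemma sum_bool_half : \sum_(b : bool) 2^-1 = 1 :> C.
Proof. by rewrite big_bool /=; field. Qed.

Lemma game_effectP ev q : effect (game_effect ev q).
Proof.
apply: effect_mix => [_||b]; first by rewrite invr_ge0 ler0n.
  exact: sum_bool_half.
apply: effect_mix => [z||z]; [exact: pmf_ge0|exact: pmf_sum1|].
apply: effect_mix => [y||y]; [exact: pmf_ge0|exact: pmf_sum1|].
exact: run_effect.
Qed.

Lemma sum_game_effect ev (w : keys -> 'M[C]_d) :
  \sum_q game_effect ev q (w q) =
  \sum_(b : bool) 2^-1 *
  \sum_(z : S * S * adv_state A) adv_choose A z *
  \sum_(y : {ffun 'I_n -> Y})
    protocol_share Pi (if b then z.1.2 else z.1.1) y *
  \sum_(q : keys)
    run q (ev b) (adv_attack z.2 (first_ciphertexts y q)) set0 set0 (w q).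
Proof.
rewrite exchange_big; apply: eq_bigr => b _; rewrite -mulr_sumr; congr (_ * _).
rewrite exchange_big; apply: eq_bigr => z _; rewrite -mulr_sumr; congr (_ * _).
by rewrite exchange_big; apply: eq_bigr => y _; rewrite -mulr_sumr.
Qed.

Lemma game_effect_split (J : finType) (P : pred J)
    (ev : bool -> bool -> {set 'I_n} -> bool)
    (evs : J -> bool -> bool -> {set 'I_n} -> bool) q rho :
    (forall b b' T, (ev b b' T)%:R = \sum_(j | P j) (evs j b b' T)%:R :> C) ->
  game_effect ev q rho = \sum_(j | P j) game_effect (evs j) q rho.
Proof.
move=> hev; rewrite exchange_big; apply: eq_bigr => b _.
rewrite -mulr_sumr; congr (_ * _).
rewrite exchange_big; apply: eq_bigr => z _; rewrite -mulr_sumr; congr (_ * _).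
rewrite exchange_big; apply: eq_bigr => y _; rewrite -mulr_sumr; congr (_ * _).
by apply: run_split => b' T; apply: hev.
Qed.

End GameEffect.

(** [x = false] is winning; [x = true] is guessing wrong with T unqualified, which stands in for the
    adversary with the negated guess. *)
Definition guess_event (Q : {set {set 'I_n}}) (x b b' : bool) (T : {set 'I_n}) :=
  (b (+) x == b') && (T \notin Q).

Variables (Q : {set {set 'I_n}}) (Share : G -> dist C {ffun 'I_n -> Y}).
Variables (Recover : {ffun 'I_n -> option Y} -> option G).
Variables (Encode : S -> dist C G) (Decode : G -> option S).
Hypothesis hconf : perfectly_confidential Q Share.
Variable A : adversary C Y S N d.

Local Notation Pi := (relay_protocol_of Share Recover Encode Decode).

Lemma ideal_guess_le (x : bool) (rho : 'M[C]_d) :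
    psdmx rho -> \sum_(q : keys) \tr rho = 1 ->
  \sum_q game_effect Pi A (guess_event Q x) q rho <= 2^-1.
Proof.
move=> rho_psd rho_tr; rewrite (sum_game_effect _ _ _ (fun=> rho)).
(* The probability of guessing [c] with T unqualified when [s] is shared and the first stage passed
   on [z]. *)
pose V z s (c : bool) := \sum_y dbind (Encode s) Share y *
  \sum_(q : keys) run q (fun b' T => (c == b') && (T \notin Q))
    (adv_attack (a := A) z (first_ciphertexts y q)) set0 set0 rho.
have V_secret z s s' c : V z s c = V z s' c.
  (* For each unqualified final set [T0], uniform keys make the outcome depend only on the shares in
     [T0], to which confidentiality applies. *)
  pose H (T0 : {set 'I_n}) y := \sum_(q : keys) run q (fun b' T => (c == b') && (T == T0))
    (adv_attack (a := A) z (first_ciphertexts y q)) set0 set0 rho.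
  have VE r : V z r c = \sum_(T0 | T0 \notin Q) \sum_y dbind (Encode r) Share y * H T0 y.
    rewrite exchange_big; apply: eq_bigr => y _; rewrite -mulr_sumr; congr (_ * _).
    rewrite exchange_big; apply: eq_bigr => q _; apply: run_split => b' T.
    have [TQ|TQ] := boolP (T \in Q).
      rewrite andbF big1 // => T0 T0Q; case: (T =P T0) => [eT|]; last by rewrite andbF.
      by rewrite -eT TQ in T0Q.
    rewrite (bigD1 T) //= eqxx big1 ?addr0 // => T0 /andP[_].
    by rewrite eq_sym => /negbTE->; rewrite andbF.
  rewrite !VE; apply: eq_bigr => T0 T0Q.
  apply: (encoded_expectation hconf Encode _ _ T0Q) => y y' hy.
  by apply: (uniform_keys_hide_shares (T0 := T0)) => // b' T /andP[_ /eqP].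
(* The two guesses are disjoint events of one run. *)
have V_le z s : V z s true + V z s false <= 1.
  rewrite -big_split /= -(pmf_sum1 (dbind (Encode s) Share)); apply: ler_sum => y _.
  rewrite -mulrDr -[leRHS]mulr1.
  apply: ler_wpM2l; first exact: (pmf_ge0 (dbind (Encode s) Share)).
  rewrite -rho_tr -big_split /=.
  apply: ler_sum => q _ /=.
  pose ev (c b' : bool) (T : {set 'I_n}) := (c == b') && (T \notin Q).
  have := run_split (P := xpredT) q (ev := fun _ T => T \notin Q) (evs := ev)
    (adv_attack (a := A) z (first_ciphertexts y q)) set0 set0 rho.
  rewrite big_bool /= => <-; first exact: effect_le_tr (run_effect _ _ _ _ _) _ rho_psd.
  by move=> b' T; rewrite big_bool /ev; case: b'; case: (T \in Q);
    rewrite /= ?addr0 ?add0r.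
rewrite -mulr_sumr -[leRHS]mulr1 ler_wpM2l ?invr_ge0 ?ler0n // exchange_big /=.
rewrite -(pmf_sum1 (adv_choose A)); apply: ler_sum => z _.
rewrite -mulr_sumr -[leRHS]mulr1 ler_wpM2l ?pmf_ge0 // big_bool /=.
(* The bit [b] asks for the guess [~~ x] on s1 or [x] on s0; after replacing s1 by s0 these are the
   two guesses on one secret. *)
rewrite -/(V z.2 z.1.2 (~~ x)) -/(V z.2 z.1.1 x) (V_secret _ _ z.1.1).
by case: x; rewrite ?(addrC (V _ _ false)) V_le.
Qed.

Lemma guess_le (w : cq_state C keys d) (eps : C) (x : bool) :
    (forall e, eps_private eps (key_and_rest w e)) ->
  ind_relay_pr Pi w A (guess_event Q x) <= 2^-1 + #|edge N|%:R * eps.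
Proof.
move=> hpriv; rewrite /ind_relay_pr -sum_game_effect cardE.
have w_psd : forall k, psdmx (w k) := cq_psd w.
rewrite -[leLHS](subrK (\sum_k game_effect Pi A (guess_event Q x) k
  (randomize_seq (enum (edge N)) w k))) addrC lerD //.
  under eq_bigr do rewrite randomize_all_const.
  apply: ideal_guess_le; first exact: randomize_seq_psd.
  have <- := cq_tr1 w; rewrite -(sum_tr_randomize_seq (enum (edge N)) w).
  by apply: eq_bigr => k _; rewrite randomize_all_const.
by apply: randomize_seq_distinguish => // k; apply: game_effectP.
Qed.

End Game.

Lemma card_edge_le n (N : repeater_network n) l :
  (forall i, path_length N i <= l)%N -> (#|edge N| <= n * l)%N.
Proof.
move=> hlen; rewrite card_tagged sumnE big_image /=.
rewrite -[n in (n * _)%N]card_ord -sum_nat_const.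
by apply: leq_sum => i _; rewrite card_ord.
Qed.

(** The zero test has advantage 0, which is at most [eps]. The sign allows the number of edges to be
    replaced by its bound. *)
Lemma private_eps_ge0 (C : numClosedFieldType) (I : finType) (Y : finZmodType) d
    (w : cq_state C {ffun I -> Y} d) (eps : C) e :
  eps_private eps (key_and_rest w e) -> 0 <= eps.
Proof.
have zero_effect : effect (fun _ : 'M[C]_d => 0).
  by split=> [a _ _|//|B /psdmx_tr_ge0 //]; rewrite mulr0 addr0.
move=> /(randomize_distinguish (cq_psd w) (fun=> zero_effect)).
by rewrite subrr.
Qed.

Theorem theorem3 (C : numClosedFieldType) (n l : nat) (Y G : finZmodType)
    (S : finType)
    (* network *)
    (N : repeater_network n)
    (hlen : forall i : 'I_n, (path_length N i <= l)%N)
    (* QKD keys and side information *)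
    (d : nat) (w : cq_state C {ffun edge N -> Y} d) (eps : C)
    (hpriv : forall e : edge N, eps_private eps (key_and_rest w e))
    (* secret-sharing scheme with qualified sets Q *)
    (Q : {set {set 'I_n}})
    (Share : G -> dist C {ffun 'I_n -> Y})
    (Recover : {ffun 'I_n -> option Y} -> option G)
    (hcorrect : correct_sharing Q Share Recover)
    (hconf : perfectly_confidential Q Share)
    (hlinear : linear_recover Recover)
    (* AMD code *)
    (Encode : S -> dist C G) (Decode : G -> option S)
    (hamd : exists delta : C, amd_code delta Encode Decode)
    (A : adversary C Y S N d) :
  let Pi := relay_protocol_of Share Recover Encode Decode in
  let p := ind_relay_pr Pi w A (ind_relay_win Q) in
  p <= 2^-1 + n%:R * l%:R * eps /\
  (ind_relay_pr Pi w A (corrupts_unqualified Q) = 1 ->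
   `|p - 2^-1| <= n%:R * l%:R * eps).
Proof.
have card_le : #|edge N|%:R * eps <= n%:R * l%:R * eps.
  (* A path provides an edge, hence the sign of [eps]; for [n = 0] there is no edge and both sides
     vanish. *)
  have [i _|no_path] := pickP 'I_n.
    rewrite ler_wpM2r ?(private_eps_ge0 (hpriv (first_edge N i))) //.
    by rewrite -natrM ler_nat card_edge_le.
  have n0 : n = 0%N by rewrite -(card_ord n) eq_card0.
  have : (#|edge N| <= 0 * l)%N by rewrite -n0 card_edge_le.
  by rewrite mul0n leqn0 => /eqP->; rewrite n0 !mul0r.
move=> Pi p.
have pE : p = ind_relay_pr Pi w A (guess_event Q false).
  apply: eq_bigr => b _; congr (_ * _); apply: eq_bigr => z _; congr (_ * _).
  apply: eq_bigr => y _; congr (_ * _); apply: eq_bigr => q _.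
  by case: b.
have p_le x : ind_relay_pr Pi w A (guess_event Q x) <= 2^-1 + n%:R * l%:R * eps.
  by apply: le_trans (guess_le Recover Encode Decode hconf A x hpriv) _; rewrite lerD2l.
split=> [|unq]; first by rewrite pE p_le.
have win_lose : p + ind_relay_pr Pi w A (guess_event Q true) = 1.
  rewrite pE -unq /ind_relay_pr -!sum_game_effect -big_split; apply: eq_bigr => q _ /=.
  rewrite addrC [RHS](game_effect_split Pi A (P := xpredT) (evs := guess_event Q)).
    by rewrite big_bool.
  move=> b b' T; rewrite big_bool /guess_event /corrupts_unqualified.
  by case: b; case: b'; case: (T \in Q); rewrite /= ?addr0 ?add0r.
(* The order on [C] is partial: [p] has to be real before the absolute value splits into two
   inequalities. *)
have p_ge0 : 0 <= p.
  rewrite pE /ind_relay_pr -sum_game_effect; apply: sumr_ge0 => q _.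
  by apply: (effect_ge0 (game_effectP _ _ _ _)); apply: cq_psd.
rewrite real_ler_norml ?rpredB ?ger0_real ?invr_ge0 ?ler0n //.
apply/andP; split; last by rewrite lerBlDl pE p_le.
(* Winning and losing sum to 1, so the lower bound is the upper bound for [x = true]. *)
have -> : p - 2^-1 = 2^-1 - ind_relay_pr Pi w A (guess_event Q true).
  by rewrite -(addrK (ind_relay_pr Pi w A (guess_event Q true)) p) win_lose; field.
by rewrite lerNl opprB lerBlDl p_le.
Qed.
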